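(* Let $K$ be a field, let $R=K[x,y,z]$, and let $I=(x^{t+2},y^{t+2},z^{t+2},x^2y^2z^2)\subset R$, where $t\ge 2$ is an integer. Then the algebra $R/I$ has the weak Lefschetz property if the characteristic of $K$ is zero or greater than $t+3$.
   Context: $R=K[x,y,z]$ carries the standard grading. A standard graded Artinian $K$-algebra $A$ has the weak Lefschetz property if there is a linear form $\ell\in [A]_1$ such that, for all integers $d$, the multiplication map $\times\ell:[A]_d\to[A]_{d+1}$ has maximal rank, that is, it is injective or surjective. *)

(* Defs.v *)
From HB Require Import structures.
From mathcomp Require Import all_boot all_order all_algebra.
From mathcomp Require Import generic_quotient ring_quotient.
From mathcomp Require Import boolp.
From mathcomp Require Import mpoly.

Set Implicit Arguments.
Unset Strict Implicit.
Unset Printing Implicit Defensive.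

Import GRing.Theory.
Local Open Scope ring_scope.
Local Open Scope quotient_scope.

Section GeneratedIdeal.
Variables (R : comNzRingType) (G : seq R).

Definition ideal_gen : {pred R} := fun p =>
  `[< exists c : 'I_(size G) -> R, p = \sum_(i < size G) c i * G`_i >].

Lemma ideal_genP p :
  reflect (exists c : 'I_(size G) -> R, p = \sum_(i < size G) c i * G`_i)
          (p \in ideal_gen).
Proof. exact: asboolP. Qed.

(* [idealr_closed] also demands that the ideal be proper. *)
Lemma ideal_gen_closed : 1 \notin ideal_gen -> idealr_closed ideal_gen.
Proof.
move=> I1; split=> //.
  apply/ideal_genP; exists (fun=> 0).
  by rewrite big1 // => i _; rewrite mul0r.
move=> a _ _ /ideal_genP[c ->] /ideal_genP[e ->].
apply/ideal_genP; exists (fun i => a * c i + e i).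
rewrite mulr_sumr -big_split /=; apply: eq_bigr => i _.
by rewrite mulrDl mulrA.
Qed.

End GeneratedIdeal.

Section WeakLefschetz.
Variables (A : comNzRingType) (gr : nat -> A -> Prop).

(* [gr d] is the graded piece [A]_d; in negative degrees [A]_d = 0, where
   injectivity is automatic, so d ranges over nat. *)
Definition has_maximal_rank (l : A) (d : nat) : Prop :=
  (forall a b, gr d a -> gr d b -> l * a = l * b -> a = b) \/
  (forall b, gr d.+1 b -> exists2 a, gr d a & l * a = b).

Definition weak_lefschetz : Prop :=
  exists2 l : A, gr 1 l & forall d : nat, has_maximal_rank l d.

End WeakLefschetz.

(* The grading induced on {mpoly K[n]} / I when I is homogeneous. *)
Definition quot_piece (K : fieldType) (n : nat) (I : idealr {mpoly K[n]})
    (d : nat) (a : {ideal_quot I}) : Prop :=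
  exists2 f : {mpoly K[n]}, f \is d.-homog & a = \pi_({ideal_quot I}) f.

Section MonomialIdeal.
Variables (K : fieldType) (t : nat).

Let x : {mpoly K[3]} := 'X_(Ordinal (isT : (0 < 3)%N)).
Let y : {mpoly K[3]} := 'X_(Ordinal (isT : (1 < 3)%N)).
Let z : {mpoly K[3]} := 'X_(Ordinal (isT : (2 < 3)%N)).

Definition I_gens : seq {mpoly K[3]} :=
  [:: x ^+ (t + 2); y ^+ (t + 2); z ^+ (t + 2); x ^+ 2 * y ^+ 2 * z ^+ 2].

Definition I_t : {pred {mpoly K[3]}} := ideal_gen I_gens.

Lemma I_t_proper : 1 \notin I_t.
Proof.
apply/negP => /ideal_genP[c] /(congr1 (meval (fun=> 0))) /eqP.
rewrite meval1 !big_ord_recl big_ord0 /= !(mevalD, mevalM, rmorphXn) /= !mevalXU.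
by rewrite meval0 addn2 !expr0n /= !mulr0 !addr0 oner_eq0.
Qed.

HB.instance Definition _ :=
  isIdealr.Build {mpoly K[3]} I_t (ideal_gen_closed I_t_proper).

End MonomialIdeal.

Arguments I_t K t : clear implicits.

(* Main.v *)
(* Take l = x + y + z and n = t + 3. As R/I is standard graded, it suffices to show that
   (i) R/(I, l) vanishes in degree n, and (ii) no form f of degree at most t + 2 outside I
   satisfies l * f \in I.

   (i) In R/(I, l), a quotient of K[x, y] with z = -(x + y), put
   w_j = (-1)^j x^j y^(n-j). The relation x^2 y^2 (x+y)^2 = 0 says that the second
   differences of w vanish away from the ends, so w_j = A + B j for 2 <= j <= n - 2, while
   w_0 = w_1 = w_(n-1) = w_n = 0. The relations (x+y)^(n-1) y = (x+y)^(n-1) x = 0 are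
   alternating binomial sums of w; such sums annihilate affine sequences, so only the
   defects at the ends contribute. The determinant of the resulting 2 x 2 system
   in A and B is, up to sign, a product of integers between 1 and n, hence w = 0.

   (ii) After multiplication by a power of x, a relation l * f \in I reads
   P1 x^(t+2) + P2 y^(t+2) + P3 z^(t+2) + g x^2 y^2 z^2 = 0 modulo l, with linear forms Pi.
   Expanding it to first order at each of the three points x = 0, y = 0, z = 0 of the
   projective line l = 0 gives a cyclic 6 x 6 linear system, again invertible when
   1, ..., n are, so each Pi is a multiple of l. Hence so is g, and l can be cancelled. *)
From HB Require Import structures.
Require Import Defs.
From mathcomp Require Import all_boot all_order all_algebra.
From mathcomp Require Import ring_quotient mpoly zify ring.

Import GRing.Theory.

Set Implicit Arguments.
Unset Strict Implicit.
Unset Printing Implicit Defensive.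
Local Open Scope ring_scope.

(** * Alternating binomial sums and second differences *)

Lemma altsum_bin (R : comNzRingType) (N : nat) :
  (0 < N)%N -> \sum_(i < N.+1) (-1) ^+ i * 'C(N, i)%:R = 0 :> R.
Proof.
move=> N0; have := exprDn (1 : R) (-1) N.
rewrite subrr expr0n -[_ == _]negbK -lt0n N0 /= mulr0n => e.
rewrite [RHS]e; apply: eq_bigr => i _.
by rewrite expr1n mul1r mulr_natr.
Qed.

Lemma altsum_bin_id (R : comNzRingType) (N : nat) :
  (1 < N)%N -> \sum_(i < N.+1) (-1) ^+ i * 'C(N, i)%:R * i%:R = 0 :> R.
Proof.
case: N => // N N1; rewrite big_ord_recl mulr0 add0r.
rewrite -[RHS](mulr0 (- N.+1%:R)) -[X in _ = _ * X](altsum_bin R N1) mulr_sumr.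
apply: eq_bigr => i _.
have e : 'C(N.+1, i.+1)%:R * i.+1%:R = N.+1%:R * 'C(N, i)%:R :> R.
  by rewrite -!natrM mulnC -mul_bin_diag.
by rewrite /bump /= exprS -mulrA e; ring.
Qed.

Lemma altsum_bin_affine (R : comNzRingType) (N : nat) (a b : R) : (1 < N)%N ->
  \sum_(i < N.+1) (-1) ^+ i * 'C(N, i)%:R * (a + b * i%:R) = 0.
Proof.
move=> N1.
rewrite (eq_bigr (fun i : 'I_N.+1 => a * ((-1) ^+ i * 'C(N, i)%:R) +
  b * ((-1) ^+ i * 'C(N, i)%:R * i%:R))); last by move=> i _; ring.
by rewrite big_split -!mulr_sumr /= altsum_bin ?altsum_bin_id ?(ltnW N1) // !mulr0 addr0.
Qed.

(** Meant for the deviation of [w] from its affine part, which survives only at 0, 1, [N] and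
    [N + 1]; [altsum_bin_sparse_rev] treats the shifted sequence. *)
Lemma altsum_bin_sparse (R : comNzRingType) (N : nat) (u : nat -> R) :
    (1 < N)%N -> (forall j, (1 < j < N)%N -> u j = 0) ->
  \sum_(i < N.+1) (-1) ^+ i * 'C(N, i)%:R * u i =
    u 0 - N%:R * u 1 + (-1) ^+ N * u N.
Proof.
case: N => [|[|N]] // _ u0; rewrite big_ord_recr !big_ord_recl big1 => [|i _] /=.
  by rewrite /bump /= bin0 bin1 binn; ring.
by rewrite [u _]u0 ?mulr0 // /bump /=; have := ltn_ord i; lia.
Qed.

Lemma altsum_bin_sparse_rev (R : comNzRingType) (N : nat) (u : nat -> R) :
    (1 < N)%N -> (forall j, (1 < j < N)%N -> u j = 0) ->
  \sum_(i < N.+1) (-1) ^+ i * 'C(N, i)%:R * u i.+1 =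
    u 1 - (-1) ^+ N * (N%:R * u N - u N.+1).
Proof.
case: N => [|[|N]] // _ u0.
rewrite 2!big_ord_recr big_ord_recl big1 => [|i _] /=.
  by rewrite /bump /= bin0 binn binSn !exprS; ring.
by rewrite [u _]u0 ?mulr0 // /bump /=; have := ltn_ord i; lia.
Qed.

Lemma affine_of_second_diff (R : comNzRingType) (w : nat -> R) (M : nat) :
    (forall j, (j < M)%N -> w j.+2 - 2 * w j.+1 + w j = 0) ->
  forall j, (j <= M.+1)%N -> w j = w 0 + (w 1 - w 0) * j%:R.
Proof.
move=> h j; have [m] := ubnP j; elim: m j => // m IH [|[|j]] lt_jm le_jM.
- by ring.
- by ring.
have := h j le_jM; rewrite (IH j.+1) ?(IH j) //; try lia.
by move=> /(canRL (addrK _)) /(canRL (subrK _)) ->; ring.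
Qed.

(** * Vanishing in degree [N + 1] for two variables, with [N = t + 2] *)

Section TwoVariables.
Variables (R : comNzRingType) (N : nat) (X Y : R).
Hypotheses (N4 : (4 <= N)%N) (XN : X ^+ N = 0) (YN : Y ^+ N = 0).
Hypotheses (XYN : (X + Y) ^+ N = 0) (XY2 : X ^+ 2 * Y ^+ 2 * (X + Y) ^+ 2 = 0).
Hypothesis natr_reg :
  forall (k : nat) (u : R), (0 < k <= N.+1)%N -> k%:R * u = 0 -> u = 0.

Let w j := (-1) ^+ j * (X ^+ j * Y ^+ (N.+1 - j)).

Let expX0 j : (N <= j)%N -> X ^+ j = 0.
Proof. by move=> h; rewrite -(subnK h) exprD XN mulr0. Qed.

Let expY0 j : (N <= j)%N -> Y ^+ j = 0.
Proof. by move=> h; rewrite -(subnK h) exprD YN mulr0. Qed.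

Let w_second_diff j : (j < N - 4)%N -> w j.+4 - 2 * w j.+3 + w j.+2 = 0.
Proof.
(* With [k = N - j - 5], the claim is [XY2] multiplied by [(-1) ^+ j * X ^+ j * Y ^+ k]. *)
move=> lt_j; have [k Nk] : exists k, N = (j + k + 5)%N by exists (N - j - 5)%N; lia.
rewrite /w.
have -> : (N.+1 - j.+4 = k.+2)%N by lia.
have -> : (N.+1 - j.+3 = k.+3)%N by lia.
have -> : (N.+1 - j.+2 = k.+4)%N by lia.
rewrite -(mulr0 ((-1) ^+ j * X ^+ j * Y ^+ k)) -XY2 !exprS; ring.
Qed.

(** [A + B * j] is the affine function that agrees with [w] at 2 and 3. *)
Let A := w 2 - 2 * (w 3 - w 2).
Let B := w 3 - w 2.
Let u j := w j - (A + B * j%:R).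

Let u_mid j : (1 < j < N)%N -> u j = 0.
Proof.
case: j => [|[|j]] // /andP[_ lt_jN].
rewrite /u (@affine_of_second_diff _ (fun j => w j.+2) (N - 4) w_second_diff j); last lia.
by rewrite /A /B; ring.
Qed.

(** Expanding [(X + Y) ^+ N * Y] gives the alternating sum of [w], to which the affine part
    contributes 0. In [u_sum_rev] the factor [X] replaces [Y] and shifts the index. *)
Let u_sum : \sum_(i < N.+1) (-1) ^+ i * 'C(N, i)%:R * u i = 0.
Proof.
transitivity ((X + Y) ^+ N * Y); last by rewrite XYN mul0r.
rewrite addrC exprDn mulr_suml -[RHS]subr0.
rewrite -[X in _ = _ - X](@altsum_bin_affine _ N A B); last by lia.
rewrite -sumrB; apply: eq_bigr => i _; rewrite /u mulrBr; congr (_ - _).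
rewrite /w subSn; last by rewrite -ltnS.
by rewrite exprS -mulr_natr -[RHS]mul1r -[X in _ = X * _](sqrr_sign _ i); ring.
Qed.

Let u_sum_rev : \sum_(i < N.+1) (-1) ^+ i * 'C(N, i)%:R * u i.+1 = 0.
Proof.
transitivity (- ((X + Y) ^+ N * X)); last by rewrite XYN mul0r oppr0.
rewrite addrC exprDn mulr_suml -[RHS]subr0.
rewrite -[X in _ = _ - X](@altsum_bin_affine _ N (A + B) B); last by lia.
rewrite -sumrN -sumrB; apply: eq_bigr => i _; rewrite /u mulrBr; congr (_ - _).
  rewrite /w subSS !exprS -mulr_natr -[RHS]mul1r -[X in _ = X * _](sqrr_sign _ i); ring.
by congr (_ * _); ring.
Qed.

Let Nm2_reg (v : R) : (N%:R - 2) * v = 0 -> v = 0.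
Proof. by rewrite -natrB; [apply: natr_reg; lia | lia]. Qed.

Let Nm3_reg (v : R) : (N%:R - 3) * v = 0 -> v = 0.
Proof. by rewrite -natrB; [apply: natr_reg; lia | lia]. Qed.

Let N_reg (v : R) : N%:R * v = 0 -> v = 0.
Proof. by apply: natr_reg; lia. Qed.

Let N1_reg (v : R) : (N%:R + 1) * v = 0 -> v = 0.
Proof. by rewrite natr1; apply: natr_reg; lia. Qed.

Let w_end j : (j < 2)%N || (N <= j)%N -> w j = 0.
Proof.
rewrite /w => /orP[] h; last by rewrite expX0 // mul0r mulr0.
by rewrite expY0 ?mulr0 //; lia.
Qed.

Let AB0 : A = 0 /\ B = 0.
Proof.
have := u_sum; rewrite altsum_bin_sparse //; last by lia.
have := u_sum_rev; rewrite altsum_bin_sparse_rev //; last by lia.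
rewrite /u !w_end ?leqnn ?leqnSn ?orbT // -natr1 -signr_odd.
(* For odd [N] the two sums are [N(A + 2B)] and [-N(A + (N-1)B)]; for even [N] they are [(N-2)A] and
   [(N-2)(A + (N+1)B)]. *)
case: (odd N); rewrite ?expr0 ?expr1 => e1 e2.
  have A2B : A = - (2 * B).
    apply/eqP; rewrite -subr_eq0; apply/eqP; apply: N_reg.
    by rewrite -[RHS]e2; ring.
  have B0 : B = 0.
    apply: Nm3_reg; apply: N_reg; rewrite -[RHS]oppr0 -[in RHS]e1 A2B; ring.
  by rewrite A2B B0 mulr0 oppr0.
have A0 : A = 0.
  by apply: Nm2_reg; rewrite -[RHS]e2; ring.
split=> //; apply: Nm2_reg; apply: N1_reg.
by rewrite -[RHS]e1 A0; ring.
Qed.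

Lemma powers_mul_eq0 i j : (i + j = N.+1)%N -> X ^+ i * Y ^+ j = 0.
Proof.
move=> ij; have -> : j = (N.+1 - i)%N by lia.
suff wi : w i = 0.
  by rewrite -[LHS]mul1r -[X in X * _](sqrr_sign _ i) expr2 -mulrA [X in _ * X]wi mulr0.
case: (boolP ((i < 2) || (N <= i))%N) => [/w_end //|i_mid].
have : u i = 0 by apply: u_mid; lia.
by rewrite /u AB0.1 AB0.2 mul0r addr0 subr0.
Qed.

End TwoVariables.

(** * Homogeneous coefficients for membership in a homogeneous ideal *)

Section HomogeneousIdeal.
Variables (R : comNzRingType) (n : nat).
Implicit Types p q : {mpoly R[n]}.

Lemma pihomogMr d e p q : q \is e.-homog -> (e <= d)%N ->
  pihomog mdeg d (p * q) = pihomog mdeg (d - e) p * q.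
Proof.
move=> hq le_ed; rewrite [in LHS](mpolyE p) [in RHS](mpolyE p).
rewrite mulr_suml !raddf_sum /= mulr_suml.
apply: eq_bigr => m _; rewrite -scalerAl !linearZ /= -scalerAl; congr (_ *: _).
have hm : 'X_[m] * q \is (mdeg m + e).-homog by rewrite dhomogM // dhomogX.
rewrite pihomogX; case: eqP => [h|ne].
  by rewrite pihomog_dE //; move: hm; rewrite h subnK.
rewrite mul0r (pihomog_ne0 _ hm) //.
by apply/eqP => h; case: ne; rewrite -h addnK.
Qed.

Lemma pihomogMr_lt d e p q : q \is e.-homog -> (d < e)%N ->
  pihomog mdeg d (p * q) = 0.
Proof.
move=> hq lt_de; rewrite [in LHS](mpolyE p) mulr_suml raddf_sum /=.
apply: big1 => m _; rewrite -scalerAl linearZ /=.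
have hm : 'X_[m] * q \is (mdeg m + e).-homog by rewrite dhomogM // dhomogX.
by rewrite (pihomog_ne0 _ hm) ?scaler0 //; apply/eqP; lia.
Qed.

(** Projecting any expression of [f] to degree [d] keeps from each coefficient only the component of
    degree [d - e i], and nothing when [e i > d]. *)
Lemma ideal_gen_homog (G : seq {mpoly R[n]}) (e : nat -> nat) d f :
    (forall i, (i < size G)%N -> G`_i \is (e i).-homog) ->
    f \is d.-homog -> f \in ideal_gen G ->
  exists2 c : 'I_(size G) -> {mpoly R[n]}, f = \sum_(i < size G) c i * G`_i
    & forall i : 'I_(size G), if (e i <= d)%N then c i \is (d - e i).-homog else c i == 0.
Proof.
move=> hG hf /ideal_genP[c fE].
exists (fun i : 'I__ => if (e i <= d)%N then pihomog mdeg (d - e i) (c i) else 0).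
  rewrite -[LHS](pihomog_dE hf) fE raddf_sum /=; apply: eq_bigr => i _.
  have hi := hG i (ltn_ord i); case: leqP => h; first exact: pihomogMr.
  by rewrite mul0r; apply: pihomogMr_lt hi h.
by move=> i /=; case: leqP => // _; apply: pihomogP.
Qed.

End HomogeneousIdeal.

(** * The linear form and the ideal (I, l) in three variables *)

Section ThreeVariables.
Variable K : fieldType.
Local Notation R := {mpoly K[3]}.

Definition vx : R := 'X_(Ordinal (isT : (0 < 3)%N)).
Definition vy : R := 'X_(Ordinal (isT : (1 < 3)%N)).
Definition vz : R := 'X_(Ordinal (isT : (2 < 3)%N)).
Definition lin : R := vx + vy + vz.

Lemma mpoly3_rmorphism (S : comNzRingType) (f : {rmorphism K -> S}) (a b c : S) :
  exists phi : {rmorphism R -> S},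
    [/\ phi vx = a, phi vy = b, phi vz = c & forall k, phi k%:MP = f k].
Proof.
exists (mmap f (tnth [tuple a; b; c]) : {rmorphism R -> S}).
by split=> [|||k]; rewrite /= ?mmapC // mmapX mmap1U.
Qed.

Lemma mpolyX3E (m : 'X_{1..3}) :
  exists i j k, 'X_[m] = vx ^+ i * vy ^+ j * vz ^+ k /\ (mdeg m = i + j + k)%N.
Proof.
exists (m ord0), (m (lift ord0 ord0)), (m (lift ord0 (lift ord0 ord0))).
by rewrite mpolyXE_id mdegE !big_ord_recl !big_ord0 /= mulr1 addn0 mulrA addnA.
Qed.

Lemma dhomog_lin : lin \is 1.-homog.
Proof. by rewrite /lin !dhomogD // dhomogX /= mdeg1. Qed.

Variable t : nat.

Lemma dhomog_I_gens i : (i < 4)%N ->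
  (I_gens K t)`_i \is (nth 0 [:: t + 2; t + 2; t + 2; 6] i)%N.-homog.
Proof.
have hX (j : 'I_3) k : ('X_j : R) ^+ k \is k.-homog.
  by rewrite -[k in k.-homog]mul1n dhomogMn // dhomogX /= mdeg1.
rewrite /I_gens; case: i => [|[|[|[|]]]] //= _; try exact: hX.
by apply: (@dhomogM _ _ _ 4 _ 2); [apply: (@dhomogM _ _ _ 2 _ 2) | ]; exact: hX.
Qed.

Definition J_t : {pred R} := ideal_gen (lin :: I_gens K t).

Lemma J_t_proper : 1 \notin J_t.
Proof.
apply/negP => /ideal_genP[c] /(congr1 (meval (fun=> 0))) /eqP.
rewrite meval1 !big_ord_recl big_ord0 /= !(mevalD, mevalM, rmorphXn) /= !mevalXU.
by rewrite meval0 addn2 !expr0n /= !(mulr0, addr0) oner_eq0.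
Qed.

HB.instance Definition _ := isIdealr.Build R J_t (ideal_gen_closed J_t_proper).

End ThreeVariables.

Arguments J_t K t : clear implicits.

Lemma pi_eq0 (A : comNzRingType) (I : idealr A) (f : A) :
  (\pi_({ideal_quot I})%qT f == 0) = (f \in I).
Proof. by rewrite -[f in RHS]subr0 Quotient.idealrBE raddf0. Qed.

(** * Surjectivity from degree [t + 2] on *)

Section Surjectivity.
Variables (K : fieldType) (t : nat).
Hypothesis t2 : (2 <= t)%N.
Hypothesis natK_neq0 : forall k : nat, (0 < k <= t + 3)%N -> k%:R != 0 :> K.

Lemma mpolyX_in_J_t (m : 'X_{1..3}) : (t + 3 <= mdeg m)%N -> 'X_[m] \in J_t K t.
Proof.
pose Q := {ideal_quot (J_t K t)}.
pose pi : {rmorphism {mpoly K[3]} -> Q} := \pi_Q%qT.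
have pi0 f : f \in J_t K t -> pi f = 0 by move=> h; apply/eqP; rewrite [_ == _]pi_eq0.
have memJ i : (i < 5)%N -> (lin K :: I_gens K t)`_i \in J_t K t.
  move=> i5; apply/ideal_genP; exists (fun j => (val j == i)%:R).
  rewrite (bigD1 (Ordinal i5)) //= eqxx mul1r big1 ?addr0 // => j.
  by rewrite -val_eqE => /negbTE /= ->; rewrite mul0r.
have piz : pi (vz K) = - (pi (vx K) + pi (vy K)).
  by apply/eqP; rewrite -subr_eq0 opprK addrC -!rmorphD; apply/eqP/pi0/(memJ 0%N).
have natr_reg (k : nat) (u : Q) :
    (0 < k <= (t + 2).+1)%N -> k%:R * u = 0 -> u = 0.
  rewrite -addnS => hk ku0; rewrite -[u]mul1r -(rmorph1 pi) -mpolyC1.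
  rewrite -(mulVf (natK_neq0 hk)) mpolyCM rmorphM /= -mulrA.
  by rewrite mpolyC_nat rmorph_nat ku0 mulr0.
have XY0 i j : (i + j = (t + 2).+1)%N -> pi (vx K) ^+ i * pi (vy K) ^+ j = 0.
  apply: powers_mul_eq0 => //; first by lia.
  - by rewrite -rmorphXn; apply/pi0/(memJ 1%N).
  - by rewrite -rmorphXn; apply/pi0/(memJ 2%N).
  - rewrite -[_ + _]opprK -piz exprNn -rmorphXn [X in _ * X]pi0 ?mulr0 //.
    exact: (memJ 3%N).
  - by rewrite -[_ + _]opprK -piz sqrrN -!rmorphXn -!rmorphM; apply/pi0/(memJ 4%N).
have XYZ0 k i j : (t + 3 <= i + j + k)%N ->
    pi (vx K) ^+ i * pi (vy K) ^+ j * pi (vz K) ^+ k = 0.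
  (* Each factor z is traded for -(x + y), down to monomials in x and y. *)
  elim: k i j => [|k IH] i j hijk.
    (* [a] splits off a factor of degree exactly [t + 3], the degree in which [XY0] applies. *)
    rewrite mulr1; pose a := minn i (t + 3).
    have -> : i = (a + (i - a))%N by lia.
    have -> : j = ((t + 3 - a) + (j - (t + 3 - a)))%N by lia.
    by rewrite !exprD mulrACA XY0 ?mul0r //; lia.
  transitivity (- (pi (vx K) ^+ i.+1 * pi (vy K) ^+ j * pi (vz K) ^+ k +
    pi (vx K) ^+ i * pi (vy K) ^+ j.+1 * pi (vz K) ^+ k)).
    by rewrite !exprS {1}piz; ring.
  by rewrite !IH ?addr0 ?oppr0 //; lia.
move=> hm; have [i [j [k [-> hd]]]] := mpolyX3E K m.
rewrite -pi_eq0; apply/eqP; rewrite -[LHS]/(pi _) !rmorphM !rmorphXn.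
by apply: XYZ0; rewrite -hd.
Qed.

Lemma homog_surj d f : (t + 3 <= d.+1)%N -> f \is d.+1.-homog ->
  exists2 g : {mpoly K[3]}, g \is d.-homog & f - lin K * g \in I_t K t.
Proof.
move=> hd hf; have fJ : f \in J_t K t.
  rewrite (mpolyE f) big_seq rpred_sum // => m hm; rewrite -mul_mpolyC.
  by apply: idealMr; apply: mpolyX_in_J_t; rewrite (dhomog_mf hf hm).
have [|c fE hc] := @ideal_gen_homog _ _ _
  (nth 0 [:: 1; t + 2; t + 2; t + 2; 6])%N d.+1 f _ hf fJ.
  case=> [|i] /= hi; [exact: dhomog_lin | exact: dhomog_I_gens].
(* The coefficient of the generator [lin] is the preimage; the other terms lie in I. *)
exists (c ord0); first by have := hc ord0; rewrite /= subn1.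
rewrite fE big_ord_recl /= mulrC addrAC subrr add0r.
by apply/ideal_genP; exists (fun i => c (lift ord0 i)).
Qed.

End Surjectivity.

(* Coefficientwise form of the relation in [linear_syzygy]: [xi], [yi] are differences of
   coefficients of the [i]-th linear form, and [e = (-1) ^+ n]. Eliminating the [yi] leaves
   [(n - 1) * xi = - e * (sum of the other two)]. *)
Lemma cyclic_system (F : fieldType) (n e x1 x2 x3 y1 y2 y3 : F) :
    e ^+ 2 = 1 -> n - 1 - e != 0 -> n - 1 + 2 * e != 0 ->
    x1 + e * y2 = 0 -> x2 + e * y3 = 0 -> x3 + e * y1 = 0 ->
    x1 + y1 + e * (n * y2 - x2) = 0 ->
    x2 + y2 + e * (n * y3 - x3) = 0 ->
    x3 + y3 + e * (n * y1 - x1) = 0 ->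
  [/\ x1 = 0, x2 = 0, x3 = 0 & [/\ y1 = 0, y2 = 0 & y3 = 0]].
Proof.
move=> ee n1 n2 a1 a2 a3 b1 b2 b3.
have yE (u v : F) : u + e * v = 0 -> v = - (e * u).
  move=> h; rewrite -[LHS]mul1r -ee; apply/eqP; rewrite -subr_eq0 opprK.
  by rewrite -(mulr0 e) -h; apply/eqP; ring.
have reg (k u : F) : k != 0 -> k * u = 0 -> u = 0.
  by move=> k0 /eqP; rewrite mulf_eq0 (negbTE k0) => /eqP.
move: (yE _ _ a1) (yE _ _ a2) (yE _ _ a3) b1 b2 b3 => {a1 a2 a3} -> -> ->.
have red (u v w : F) : u + - (e * w) + e * (n * - (e * u) - v) =
    - ((n * e ^+ 2 - 1) * u + e * (v + w)).
  by ring.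
rewrite !red ee mulr1 => /eqP; rewrite oppr_eq0 => /eqP b1.
move=> /eqP; rewrite oppr_eq0 => /eqP b2 /eqP; rewrite oppr_eq0 => /eqP b3.
(* Subtracting two equations leaves the factor [n - 1 - e]; once the unknowns agree, [n - 1 + 2 * e]
   remains. *)
have x12 : x1 = x2.
  apply/eqP; rewrite -subr_eq0; apply/eqP/(reg _ _ n1).
  by rewrite -(subrr 0) -{1}b1 -b2; ring.
have x13 : x1 = x3.
  apply/eqP; rewrite -subr_eq0; apply/eqP/(reg _ _ n1).
  by rewrite -(subrr 0) -{1}b1 -b3; ring.
have x0 : x1 = 0 by apply: (reg _ _ n2); rewrite -b1 -x12 -x13; ring.
by rewrite -x12 -x13 x0 mulr0 oppr0.
Qed.

(** * First-order expansions and linear syzygies modulo l *)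

Lemma one_plus_X_exp (R : comNzRingType) (n : nat) :
  exists s : {poly R}, (1 + 'X) ^+ n = 1 + n%:R * 'X + 'X^2 * s.
Proof.
elim: n => [|n [s IH]]; first by exists 0; rewrite mul0r mulr0 !addr0.
by exists (n%:R + s + 'X * s); rewrite exprSr IH -natr1; ring.
Qed.

(** [-1 - 'X] is the value on l = 0 of the third variable when the others are 1 and ['X]; ['X^2 * r]
    holds what is invisible to first order. *)
Lemma low_coefs_eq0 (R : comNzRingType) (n : nat) (p0 p1 q0 q1 : R) (r : {poly R}) :
    p0%:P + p1%:P * 'X + (-1 - 'X) ^+ n * (q0%:P + q1%:P * 'X) + 'X^2 * r = 0 ->
  p0 + (-1) ^+ n * q0 = 0 /\ p1 + (-1) ^+ n * (n%:R * q0 + q1) = 0.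
Proof.
have [s sE] := one_plus_X_exp R n.
have -> : (-1 - 'X) ^+ n = (-1) ^+ n * (1 + n%:R * 'X + 'X^2 * s) :> {poly R}.
  by rewrite -sE -exprMn; congr (_ ^+ _); ring.
move=> h.
have {h} : (p0 + (-1) ^+ n * q0)%:P + (p1 + (-1) ^+ n * (n%:R * q0 + q1))%:P * 'X +
   'X^2 * (r + (-1) ^+ n * (n%:R * q1%:P + s * (q0%:P + q1%:P * 'X))) = 0.
  by rewrite -[RHS]h !(rmorphD, rmorphM, rmorphXn, rmorphN, rmorph1, rmorph_nat) /=; ring.
move=> h; have := congr1 (coefp 0) h; have := congr1 (coefp 1) h => {h}.
rewrite /= !coefD !coefMX !coefC !coefXnM /=.
by rewrite add0r !addr0.
Qed.

Section LinearFormRelations.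
Variable K : fieldType.
Local Notation R := {mpoly K[3]}.

Lemma dhomog1P (p : R) : p \is 1.-homog ->
  exists a b c : K, p = a%:MP * vx K + b%:MP * vy K + c%:MP * vz K.
Proof.
move=> hp; rewrite (mpolyE p) big_seq.
apply: (big_ind (fun p : R => exists a b c : K,
  p = a%:MP * vx K + b%:MP * vy K + c%:MP * vz K)).
- by exists 0, 0, 0; rewrite mpolyC0; ring.
- move=> _ _ [a [b [c ->]]] [a' [b' [c' ->]]].
  by exists (a + a'), (b + b'), (c + c'); rewrite !mpolyCD; ring.
move=> m hm; have [i [j [k [-> hd]]]] := mpolyX3E K m.
rewrite -mul_mpolyC; move: (p@_m) => u.
move: hd; rewrite (dhomog_mf hp hm); case: i j k => [|[|i]] [|[|j]] [|[|k]] //= _.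
- by exists 0, 0, u; rewrite mpolyC0; ring.
- by exists 0, u, 0; rewrite mpolyC0; ring.
- by exists u, 0, 0; rewrite mpolyC0; ring.
Qed.

Variables (N : nat) (P1 P2 P3 g h : R).
Hypothesis N4 : (4 <= N)%N.
Hypothesis natK_neq0 : forall k : nat, (0 < k <= N.+1)%N -> k%:R != 0 :> K.
Hypotheses (hP1 : P1 \is 1.-homog) (hP2 : P2 \is 1.-homog) (hP3 : P3 \is 1.-homog).
Hypothesis relP : P1 * vx K ^+ N + P2 * vy K ^+ N + P3 * vz K ^+ N +
  g * (vx K ^+ 2 * vy K ^+ 2 * vz K ^+ 2) = lin K * h.

Lemma linear_syzygy : exists a1 a2 a3 : K,
  [/\ P1 = a1%:MP * lin K, P2 = a2%:MP * lin K & P3 = a3%:MP * lin K].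
Proof.
have [a1 [b1 [c1 P1E]]] := dhomog1P hP1.
have [a2 [b2 [c2 P2E]]] := dhomog1P hP2.
have [a3 [b3 [c3 P3E]]] := dhomog1P hP3.
have XN : 'X^N = 'X^2 * 'X^(N - 2) :> {poly K} by rewrite -exprD subnKC //; lia.
have relE (phi : {rmorphism R -> {poly K}}) : phi (lin K) = 0 ->
    phi P1 * phi (vx K) ^+ N + phi P2 * phi (vy K) ^+ N +
    phi P3 * phi (vz K) ^+ N +
    phi g * (phi (vx K) ^+ 2 * phi (vy K) ^+ 2 * phi (vz K) ^+ 2) = 0.
  move=> phi0; have := congr1 phi relP.
  by rewrite [in RHS]rmorphM phi0 mul0r => <-; rewrite !(rmorphD, rmorphM, rmorphXn).
(* Each substitution is a parametrization of [x + y + z = 0] around the point where one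
   of the variables, sent to ['X], vanishes. *)
have [phiz [zx zy zz zC]] := mpoly3_rmorphism (@polyC K) 1 (-1 - 'X) 'X.
have [phix [xx xy xz xC]] := mpoly3_rmorphism (@polyC K) 'X 1 (-1 - 'X).
have [phiy [yx yy yz yC]] := mpoly3_rmorphism (@polyC K) (-1 - 'X) 'X 1.
(* Under [phiz], [P1] becomes [(a1 - b1) + (c1 - b1) * 'X], and [P2] likewise; the terms of [P3] and
   [g] are divisible by ['X^2]. *)
have [E0z E1z] : (a1 - b1) + (-1) ^+ N * (a2 - b2) = 0 /\
    (c1 - b1) + (-1) ^+ N * (N%:R * (a2 - b2) + (c2 - b2)) = 0.
  apply: (@low_coefs_eq0 _ _ _ _ _ _ (phiz P3 * 'X^(N - 2) + phiz g * (-1 - 'X) ^+ 2)).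
  have := relE phiz; rewrite /lin !rmorphD zx zy zz => /(_ ltac:(ring)) <-.
  by rewrite P1E P2E !(rmorphD, rmorphM, rmorphN) !zC zx zy zz /= expr1n XN; ring.
have [E0x E1x] : (b2 - c2) + (-1) ^+ N * (b3 - c3) = 0 /\
    (a2 - c2) + (-1) ^+ N * (N%:R * (b3 - c3) + (a3 - c3)) = 0.
  apply: (@low_coefs_eq0 _ _ _ _ _ _ (phix P1 * 'X^(N - 2) + phix g * (-1 - 'X) ^+ 2)).
  have := relE phix; rewrite /lin !rmorphD xx xy xz => /(_ ltac:(ring)) <-.
  by rewrite P2E P3E !(rmorphD, rmorphM, rmorphN) !xC xx xy xz /= expr1n XN; ring.
have [E0y E1y] : (c3 - a3) + (-1) ^+ N * (c1 - a1) = 0 /\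
    (b3 - a3) + (-1) ^+ N * (N%:R * (c1 - a1) + (b1 - a1)) = 0.
  apply: (@low_coefs_eq0 _ _ _ _ _ _ (phiy P2 * 'X^(N - 2) + phiy g * (-1 - 'X) ^+ 2)).
  have := relE phiy; rewrite /lin !rmorphD yx yy yz => /(_ ltac:(ring)) <-.
  by rewrite P3E P1E !(rmorphD, rmorphM, rmorphN) !yC yx yy yz /= expr1n XN; ring.
(* In these unknowns [c1 - b1] is [x1 + y1] and [c2 - b2] is [- x2], and so on cyclically. *)
have [] := @cyclic_system K N%:R ((-1) ^+ N) (a1 - b1) (b2 - c2) (c3 - a3)
  (c1 - a1) (a2 - b2) (b3 - c3).
- exact: sqrr_sign.
(* The two factors are [N] and [N - 3] for odd [N], [N - 2] and [N + 1] for even [N]. *)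
- rewrite -signr_odd; case: (odd N); rewrite ?expr1 ?expr0.
    by rewrite opprK subrK natK_neq0 //; lia.
  by rewrite -addrA -opprD -mulr2n -natrB ?natK_neq0 //; lia.
- rewrite -signr_odd; case: (odd N); rewrite ?expr1 ?expr0.
    by rewrite mulrN1 -addrA -opprD nat1r -natrB ?natK_neq0 //; lia.
  by rewrite mulr1 -addrA [-1 + 2]addrC addrK natr1 natK_neq0 //; lia.
- by [].
- by [].
- by [].
- by rewrite -E1z; ring.
- by rewrite -E1x; ring.
- by rewrite -E1y; ring.
have eqB (u v : K) : u - v = 0 -> u = v by move/eqP; rewrite subr_eq0 => /eqP.
move=> /eqB ab1 /eqB bc2 /eqB ca3 [/eqB ca1 /eqB ab2 /eqB bc3].
exists a1, a2, a3; rewrite P1E P2E P3E /lin.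
by rewrite -ab1 ca1 -bc2 -ab2 bc3 ca3; split; ring.
Qed.

End LinearFormRelations.

(** * Injectivity up to degree [t + 2] *)

Section Injectivity.
Variable K : fieldType.
Local Notation R := {mpoly K[3]}.

Lemma lin_neq0 : lin K != 0.
Proof.
have [ev [ex ey ez _]] := mpoly3_rmorphism (idfun : {rmorphism K -> K}) 1 0 0.
apply: contra_neq (oner_neq0 K) => /(congr1 ev).
by rewrite /lin !rmorphD ex ey ez !addr0 rmorph0.
Qed.

(** Substituting -(x + y) for z realizes R/(l) inside the domain R, where the nonzero images of the
    variables can be cancelled. *)
Lemma mod_lin_rmorphism : exists phi : {rmorphism R -> R},
  [/\ phi (vx K) != 0, phi (vy K) != 0, phi (vz K) != 0, phi (lin K) = 0 &
    forall p, phi p = 0 -> exists q, p = lin K * q].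
Proof.
have [phi [px py pz pC]] :=
  mpoly3_rmorphism (@mpolyC 3 K) (vx K) (vy K) (- (vx K + vy K)).
have [ev [ex ey ez _]] := mpoly3_rmorphism (idfun : {rmorphism K -> K}) 1 0 0.
have [ew [wx wy wz _]] := mpoly3_rmorphism (idfun : {rmorphism K -> K}) 0 1 0.
exists phi; split.
- by apply: contra_neq (oner_neq0 K) => /(congr1 ev); rewrite px ex rmorph0.
- by apply: contra_neq (oner_neq0 K) => /(congr1 ew); rewrite py wy rmorph0.
- rewrite pz oppr_eq0; apply: contra_neq (oner_neq0 K) => /(congr1 ev).
  by rewrite rmorphD ex ey addr0 rmorph0.
- by rewrite /lin !rmorphD px py pz subrr.
move=> p p0.
suff [q qE] : exists q, p - phi p = lin K * q by exists q; rewrite -qE p0 subr0.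
elim/mpolyind: p {p0} => [|c m p _ _ [q qE]].
  by exists 0; rewrite rmorph0 subr0 mulr0.
have [i [j [k [mE _]]]] := mpolyX3E K m.
(* z minus its image is l, which divides the difference of the k-th powers. *)
have [s sE] : exists s, vz K ^+ k - (- (vx K + vy K)) ^+ k = lin K * s.
  by eexists; rewrite subrXX opprK [X in X * _]addrC; reflexivity.
exists (c%:MP * vx K ^+ i * vy K ^+ j * s + q).
rewrite mulrDr -qE rmorphD /= -mul_mpolyC mE !rmorphM !rmorphXn px py pz pC /=.
transitivity (c%:MP * vx K ^+ i * vy K ^+ j * (lin K * s) + (p - phi p)).
  by rewrite -sE; ring.
by ring.
Qed.

Variable t : nat.
Hypothesis t2 : (2 <= t)%N.
Hypothesis natK_neq0 : forall k : nat, (0 < k <= t + 3)%N -> k%:R != 0 :> K.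

Lemma homog_inj d (f : R) : (d <= t + 2)%N -> f \is d.-homog ->
  lin K * f \in I_t K t -> f \in I_t K t.
Proof.
move=> hd hf hI.
have hlf : lin K * f \is d.+1.-homog by exact: (dhomogM (dhomog_lin K) hf).
have [|c fE hc] := @ideal_gen_homog _ _ _
  (nth 0 [:: t + 2; t + 2; t + 2; 6])%N d.+1 _ _ hlf hI.
  by move=> i; exact: dhomog_I_gens.
move: fE; rewrite !big_ord_recl big_ord0 addr0.
have := hc ord0; have := hc (lift ord0 ord0); have := hc (lift ord0 (lift ord0 ord0)).
move: (c _) (c _) (c _) (c _) => {hI hc} p4 p1 p2 p3 /= h3 h2 h1.
rewrite -/(vx K) -/(vy K) -/(vz K) => fE.
have [phi [phix phiy phiz phi_lin phi_ker]] := mod_lin_rmorphism.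
(* [vx K ^+ k] lifts the relation to degree [t + 3], making the coefficients of the pure powers
   linear forms, possibly 0. *)
pose k := (t + 2 - d)%N.
have hxk (p : R) :
    (if (t + 2 <= d.+1)%N then p \is (d.+1 - (t + 2)).-homog else p == 0) ->
    vx K ^+ k * p \is 1.-homog.
  case: leqP => [le_td hp|_ /eqP->]; last by rewrite mulr0 dhomog0.
  have e : (1 * k + (d.+1 - (t + 2)) = 1)%N by rewrite /k; lia.
  have := dhomogM (dhomogMn k (_ : vx K \is 1.-homog)) hp; rewrite e; apply.
  by rewrite dhomogX /= mdeg1.
have lin_mul_phi (a : K) (p : R) : vx K ^+ k * p = a%:MP * lin K -> phi p = 0.
  move=> /(congr1 phi); rewrite [RHS]rmorphM phi_lin mulr0 rmorphM rmorphXn => /eqP.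
  by rewrite mulf_eq0 expf_eq0 (negbTE phix) andbF => /eqP.
have [|||a1 [a2 [a3 [/lin_mul_phi p10 /lin_mul_phi p20 /lin_mul_phi p30]]]] :=
  @linear_syzygy K (t + 2) (vx K ^+ k * p1) (vx K ^+ k * p2) (vx K ^+ k * p3)
  (vx K ^+ k * p4) (vx K ^+ k * f) _ _ (hxk _ h1) (hxk _ h2) (hxk _ h3).
- by lia.
- by move=> j; rewrite -addnS; apply: natK_neq0.
- by rewrite [RHS]mulrCA fE; ring.
(* Modulo l only the term of x^2 y^2 z^2 is left in the relation. *)
have p40 : phi p4 = 0.
  have /eqP := congr1 phi fE.
  rewrite [phi (lin K * f)]rmorphM phi_lin mul0r !rmorphD !rmorphM !rmorphXn p10 p20 p30.
  rewrite !mul0r !add0r eq_sym !mulf_eq0 (negbTE phix) (negbTE phiy) (negbTE phiz).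
  by rewrite !orbF => /eqP.
have [q1 e1] := phi_ker _ p10; have [q2 e2] := phi_ker _ p20.
have [q3 e3] := phi_ker _ p30; have [q4 e4] := phi_ker _ p40.
apply/ideal_genP; exists (fun i => nth 0 [:: q1; q2; q3; q4] i).
apply: (mulfI lin_neq0); rewrite fE e1 e2 e3 e4 !big_ord_recl big_ord0 /=.
by rewrite -/(vx K) -/(vy K) -/(vz K); ring.
Qed.

End Injectivity.

(** * The characteristic hypothesis and the conclusion *)

Lemma pchar_natr_neq0 (K : fieldType) (n : nat) :
    [pchar K] =i pred0 \/ (exists2 p : nat, p \in [pchar K] & (n < p)%N) ->
  forall k : nat, (0 < k <= n)%N -> k%:R != 0 :> K.
Proof.
move=> hchar k /andP[k0 le_kn]; case: hchar => [/pcharf0P -> | [p hp lt_np]].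
  by rewrite -lt0n.
by rewrite -(dvdn_pcharf hp) gtnNdvd // (leq_ltn_trans le_kn).
Qed.

Theorem corollary3p4 (K : fieldType) (t : nat) (ht : (2 <= t)%N)
    (hchar : [pchar K] =i pred0 \/
             exists2 p : nat, p \in [pchar K] & (t + 3 < p)%N) :
  weak_lefschetz (A := {ideal_quot (I_t K t)}) (quot_piece (I := I_t K t)).
Proof.
have natK_neq0 := pchar_natr_neq0 hchar.
pose pi : {rmorphism {mpoly K[3]} -> {ideal_quot (I_t K t)}} :=
  \pi_({ideal_quot (I_t K t)})%qT.
have pi_eq f g : pi f = pi g <-> f - g \in I_t K t.
  by rewrite Quotient.idealrBE; split=> [->|/eqP].
exists (pi (lin K)); first by exists (lin K) => //; exact: dhomog_lin.
(* Both alternatives are available at [d = t + 2]; it is put on the injective side. *)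
move=> d; case: (leqP d (t + 2)) => [le_dt | lt_td]; [left | right].
  move=> _ _ [f hf ->] [g hg ->]; rewrite -!(rmorphM pi) => /pi_eq h.
  by apply/pi_eq; apply: (homog_inj ht natK_neq0 le_dt); rewrite ?rpredB // mulrBr.
move=> _ [f hf ->]; have [|g hg h] := homog_surj ht natK_neq0 _ hf; first by lia.
exists (pi g); first by exists g.
by rewrite -rmorphM; apply/esym/pi_eq.
Qed.
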